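(* Consider the perturbed Lur'e-type system and the observer of the context with $E=0$. Suppose there exist $P\succ0$ (symmetric), a diagonal $\Lambda\succ0$ (for which, together with $\Gamma$, the incremental sector condition of the context holds), $q>0$, and $K,K'\in\mathbb{R}^{n\times n_y}$ such that $$\begin{pmatrix}\mathrm{He}\{P(A_{K'}-KC)\}+qI & PW_{K'}+\Gamma\Lambda\\ (PW_{K'}+\Gamma\Lambda)^\top&-2\Lambda\end{pmatrix}\preceq0,\qquad A_{K'}=(I-K'C)A,\quad W_{K'}=(I-K'C)W,$$ and suppose that for $t\ge T_0$ the signal $\hat z_2$ satisfies, for each $j=1,\dots,n_y$, $$\hat z_{2,j}(t)=[CAx(t)+CWf(x(t))]_j+\varepsilon_{2,j}(t),\qquad |\varepsilon_{2,j}(t)|\le c_0\,\bar\nu^{1/2}+c_1\,\bar p .$$ Define $\bar\varepsilon_2=\sqrt{n_y}\,(c_0\bar\nu^{1/2}+c_1\bar p)$. Then the error $e(t)=\hat x(t)-x(t)$ satisfies, for $t\ge T_0$, $$\|e(t)\|\le\kappa_P\Bigl(e^{-\rho(t-T_0)}\|e(T_0)\|+\frac1\rho\bigl(\|K\|\bar\nu+\|K'\|\bar\varepsilon_2+\bar p\bigr)\Bigr),$$ where $\kappa_P=\sqrt{\lambda_{\max}(P)/\lambda_{\min}(P)}$ and $\rho=q/(2\lambda_{\max}(P))$.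
   Context: System: $\dot x=Ax+Wf(x)+Bu+p(t)$, $y=Cx+\nu(t)$, with state $x\in\mathbb{R}^n$, input $u\in\mathbb{R}^{n_u}$, measured output $y\in\mathbb{R}^{n_y}$, known matrices $A,W\in\mathbb{R}^{n\times n}$, $B\in\mathbb{R}^{n\times n_u}$, $C\in\mathbb{R}^{n_y\times n}$, and disturbances with $\|p(t)\|\le\bar p$, $\|\nu(t)\|\le\bar\nu$ for all $t$. The nonlinearity $f:\mathbb{R}^n\to\mathbb{R}^n$ is $C^1$ and Lipschitz continuous. Incremental sector condition: with diagonal $\Gamma=\mathrm{diag}(\gamma_1,\dots,\gamma_n)\succeq0$ and $\Lambda=\mathrm{diag}(\lambda_1,\dots,\lambda_n)\succ0$, for all $x,\hat x\in\mathbb{R}^n$, setting $\delta=f(\hat x)-f(x)$ and $e=\hat x-x$, one has $\sum_{i=1}^n\lambda_i\delta_i(\delta_i-\gamma_ie_i)\le0$. Observer (with $E=0$): $\dot{\hat x}=A\hat x+Wf(\hat x)+K(y-C\hat x)-K'\bigl(CA\hat x+CWf(\hat x)-\hat z_2\bigr)+Bu$, where $\hat z_2=(\hat z_{2,1},\dots,\hat z_{2,n_y})^\top$ is produced from $(y,u)$ by the sliding-mode observers $\dot{\hat z}_{1,j}=\hat z_{2,j}+[CBu]_j+L_jk_1|y_j-\hat z_{1,j}|^{1/2}\mathrm{sign}(y_j-\hat z_{1,j})$, $\dot{\hat z}_{2,j}\in L_j^2k_2\,\mathrm{sign}(y_j-\hat z_{1,j})$ with $L_j,k_1,k_2>0$,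 understood in the Filippov sense. The nonnegative constants $c_0,c_1$ in the reconstruction-error bound are of order $c_0=O(L_j)$, $c_1=O(1)$ with respect to the gains $L_j$. Notation: $\mathrm{He}\{X\}=X+X^\top$; $[v]_j$ is the $j$-th component of $v$; $\|\cdot\|$ is the Euclidean norm for vectors and the induced 2-norm for matrices. *)

(* Defs.v *)
From HB Require Import structures.
From mathcomp Require Import all_boot all_order all_algebra.
From mathcomp Require Import all_classical all_reals all_analysis.

Set Implicit Arguments.
Unset Strict Implicit.
Unset Printing Implicit Defensive.

Import Order.TTheory GRing.Theory Num.Theory.
Import numFieldNormedType.Exports.

Local Open Scope classical_set_scope.
Local Open Scope ring_scope.

Section linear_algebra.
Context {R : realType}.

(* The library norm on matrices is the max norm of the entries; the Euclidean
   norm and the norm it induces on matrices are therefore defined here. *)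
Definition enorm n (v : 'cV[R]_n) : R := Num.sqrt (\sum_i v i 0 ^+ 2).

(* The closed unit ball, rather than the unit sphere, keeps the set nonempty
   in dimension 0. *)
Definition opnorm m n (M : 'M[R]_(m, n)) : R :=
  sup [set enorm (M *m v) | v in [set v : 'cV[R]_n | enorm v <= 1]].

Definition He n (X : 'M[R]_n) : 'M[R]_n := X + X^T.

Definition qform n (M : 'M[R]_n) (v : 'cV[R]_n) : R := (v^T *m M *m v) 0 0.

Definition posdefmx n (M : 'M[R]_n) : Prop :=
  M^T = M /\ forall v, v != 0 -> 0 < qform M v.

Definition possemidefmx n (M : 'M[R]_n) : Prop :=
  M^T = M /\ forall v, 0 <= qform M v.

Definition negsemidefmx n (M : 'M[R]_n) : Prop :=
  M^T = M /\ forall v, qform M v <= 0.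

(* Meant for symmetric matrices of positive size, whose (real) spectrum is
   finite and nonempty. *)
Definition lambda_max n (M : 'M[R]_n) : R := sup [set a | eigenvalue M a].
Definition lambda_min n (M : 'M[R]_n) : R := inf [set a | eigenvalue M a].

End linear_algebra.

Section nonlinearity.
Context {R : realType}.

Definition C1 n (f : 'cV[R]_n -> 'cV[R]_n) : Prop :=
  (forall x, differentiable f x) /\
  (forall v, continuous (fun x => 'D_v f x)).

Definition elipschitz n (f : 'cV[R]_n -> 'cV[R]_n) : Prop :=
  exists l : R, forall x y, enorm (f x - f y) <= l * enorm (x - y).

Definition incremental_sector n (f : 'cV[R]_n -> 'cV[R]_n)
    (gam lam : 'rV[R]_n) : Prop :=
  forall x xh : 'cV[R]_n,
    let delta := f xh - f x in
    let e := xh - x in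
    \sum_i lam 0 i * delta i 0 * (delta i 0 - gam 0 i * e i 0) <= 0.

End nonlinearity.

Section solutions.
Context {R : realType}.

(* Absolute continuity on every compact subinterval of [0, +oo[. *)
Definition loc_abs_continuous (V : normedModType R) (x : R -> V) : Prop :=
  forall a b eps : R, 0 <= a -> a <= b -> 0 < eps ->
  exists2 d : R, 0 < d &
    forall (N : nat) (s t : 'I_N -> R),
      (forall i, [/\ a <= s i, s i <= t i & t i <= b]) ->
      trivIset setT (fun i => `]s i, t i[%classic) ->
      \sum_i (t i - s i) < d ->
      \sum_i `|x (t i) - x (s i)| < eps.

(* Solution on [0, +oo[ of x' = F(t, x): the exogenous signals entering F are
   not assumed continuous, so the equation holds for almost every t. *)
Definition caratheodory_solution (V : normedModType R)
    (F : R -> V -> V) (x : R -> V) : Prop :=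
  loc_abs_continuous x /\
  {ae (@lebesgue_measure R), forall t : R,
    0 <= t -> is_derive t (1 : R) x (F t (x t))}.

Definition closed_convex_hull (V : normedModType R) (S : set V) : set V :=
  \bigcap_(D in [set D : set V | [/\ closed D,
       convex_set (D : set (convex_lmodType V)) & S `<=` D]]) D.

(* Filippov regularization of a vector field of the plane. *)
Definition filippov (g : R * R -> R * R) (z : R * R) : set (R * R) :=
  \bigcap_(d in [set d : R | 0 < d])
  \bigcap_(N in [set N : set (R * R) |
       (lebesgue_measure \x lebesgue_measure)%E.-negligible N])
    closed_convex_hull (g @` (ball z d `\` N)).

Definition filippov_solution (G : R -> R * R -> R * R) (z : R -> R * R) : Prop :=
  loc_abs_continuous z /\
  {ae (@lebesgue_measure R), forall t : R, 0 <= t ->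
    exists2 v, is_derive t (1 : R) z v & filippov (G t) (z t) v}.

End solutions.

Section system_and_observer.
Context {R : realType}.

Definition lure_field n nu (A W : 'M[R]_n) (B : 'M[R]_(n, nu))
    (f : 'cV[R]_n -> 'cV[R]_n) (u : R -> 'cV[R]_nu) (p : R -> 'cV[R]_n)
    (t : R) (x : 'cV[R]_n) : 'cV[R]_n :=
  A *m x + W *m f x + B *m u t + p t.

Definition observer_field n nu ny (A W : 'M[R]_n) (B : 'M[R]_(n, nu))
    (C : 'M[R]_(ny, n)) (K K' : 'M[R]_(n, ny)) (f : 'cV[R]_n -> 'cV[R]_n)
    (u : R -> 'cV[R]_nu) (y zh2 : R -> 'cV[R]_ny)
    (t : R) (xh : 'cV[R]_n) : 'cV[R]_n :=
  A *m xh + W *m f xh + K *m (y t - C *m xh)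
  - K' *m (C *m A *m xh + C *m W *m f xh - zh2 t) + B *m u t.

(* Discontinuous field of one sliding-mode observer, with gain L, state
   z = (zh_1, zh_2), scalar output yj and known input term cbu. *)
Definition smo_field (L k1 k2 : R) (cbu yj : R -> R) (t : R) (z : R * R) :
    R * R :=
  (z.2 + cbu t + L * k1 * Num.sqrt `|yj t - z.1| * Num.sg (yj t - z.1),
   L ^+ 2 * k2 * Num.sg (yj t - z.1)).

(* c = O(g) as all the components of the gain vector tend to +oo. *)
Definition gain_bigO ny (c g : ('I_ny -> R) -> R) : Prop :=
  exists M L0 : R, forall L, (forall j, L0 <= L j) -> `|c L| <= M * `|g L|.

End system_and_observer.

(* Main.v *)
Require Import Defs.
From HB Require Import structures.
From mathcomp Require Import all_boot all_order all_algebra.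
From mathcomp Require Import all_classical all_reals all_analysis.
From mathcomp Require Import ring lra.
Import Order.TTheory GRing.Theory Num.Theory.
Import numFieldNormedType.Exports.
Local Open Scope classical_set_scope.
Local Open Scope ring_scope.

(** The error bound is a Lyapunov estimate for V = e^T P e.

    Substituting the measurement and the reconstructed signal into the observer
    gives e' = F e + G delta + d, where F = A_{K'} - K C, G = W_{K'},
    delta = f xh - f x, and d = K nu + K' eps - p satisfies |d| <= D with
    D = |K| nubar + |K'| epsbar + pbar ([error_field]).  Evaluating the matrix
    inequality at the vector (e, delta) and removing the sector terms, whose
    sign is favourable, leaves e^T P (F e + G delta) <= - (q / 2) |e|^2
    ([lmi_dissipation]).  Since V <= lambda_max |e|^2, and by Cauchy-Schwarz for
    the form of P,
      V' / 2 <= - rho V + sqrt lambda_max D sqrt V,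
    that is, formally, (sqrt V)' <= - rho sqrt V + sqrt lambda_max D.
    Integrating gives
      sqrt V (t) <= exp (- rho (t - T0)) sqrt V (T0)
                    + sqrt lambda_max D / rho
    ([lyapunov_decay]), and comparing V with |e|^2 at both ends produces the
    factor kappa_P.

    Two points need real work.

    The trajectories are absolutely continuous and the differential inequality
    holds almost everywhere only.  What replaces the mean value theorem is
    [abs_continuous_nonincreasing]: an absolutely continuous function whose
    derivative is nonpositive almost everywhere is nonincreasing.  It is proved
    by real induction and outer regularity of the Lebesgue measure, without
    integrating the derivative; the Gronwall inequality
    [abs_continuous_gronwall] follows from it.

    The constants lambda_max and lambda_min are extrema of the set of
    eigenvalues, and they must be shown to bound the quadratic form of P.  This
    is [lambda_maxP], where compactness of the sphere is replaced by an
    algebraic fact: a nonnegative form given by an invertible matrix is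
    coercive ([psd_unit_coercive]). *)

(** * Positive semidefinite forms and the Euclidean norm *)

Section QuadraticForms.
Context {R : realType} {n : nat}.
Implicit Types (M N : 'M[R]_n) (a b v : 'cV[R]_n) (k : R).

Definition bform M a b : R := (a^T *m M *m b) 0 0.

Lemma bformDl M a b v : bform M (a + b) v = bform M a v + bform M b v.
Proof. by rewrite /bform linearD /= !mulmxDl mxE. Qed.

Lemma bformDr M a b v : bform M v (a + b) = bform M v a + bform M v b.
Proof. by rewrite /bform mulmxDr mxE. Qed.

Lemma bformZl M k a b : bform M (k *: a) b = k * bform M a b.
Proof. by rewrite /bform linearZ /= -!scalemxAl mxE. Qed.

Lemma bformZr M k a b : bform M a (k *: b) = k * bform M a b.
Proof. by rewrite /bform -scalemxAr mxE. Qed.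

Lemma bform_mxD M N a b : bform (M + N) a b = bform M a b + bform N a b.
Proof. by rewrite /bform mulmxDr mulmxDl mxE. Qed.

Lemma bform_mxZ (k : R) M a b : bform (k *: M) a b = k * bform M a b.
Proof. by rewrite /bform -scalemxAr -scalemxAl mxE. Qed.

Lemma bform_mulmx M N a b : bform (M *m N) a b = bform M a (N *m b).
Proof. by rewrite /bform !mulmxA. Qed.

Lemma bform_tr M a b : bform M^T a b = bform M b a.
Proof.
rewrite /bform.
have -> : (b^T *m M *m a) 0 0 = ((b^T *m M *m a)^T) 0 0 by rewrite [RHS]mxE.
by rewrite !trmx_mul trmxK mulmxA.
Qed.

Lemma bformC M a b : M^T = M -> bform M a b = bform M b a.
Proof. by move=> sM; rewrite -bform_tr sM. Qed.

Lemma qformE M v : qform M v = bform M v v. Proof. by []. Qed.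

Lemma qformD M a b : M^T = M ->
  qform M (a + b) = qform M a + 2 * bform M a b + qform M b.
Proof.
move=> sM; rewrite !qformE !(bformDl, bformDr) (bformC _ b a) //; ring.
Qed.

Lemma qformZ M k v : qform M (k *: v) = k ^+ 2 * qform M v.
Proof. by rewrite !qformE bformZl bformZr; ring. Qed.

Lemma qformN M v : qform M (- v) = qform M v.
Proof. by rewrite -scaleN1r qformZ; ring. Qed.

Lemma qform0 M : qform M 0 = 0.
Proof. by rewrite -(scale0r 0) qformZ; ring. Qed.

(** The form may vanish at a nonzero vector, so the usual minimization of
    Q(b - s a) over s is not available.  The form is evaluated instead at
    Q(b) a - B(a, b) b and Q(a) b - B(a, b) a, which settles every case but
    Q(a) = Q(b) = 0. *)
Lemma psd_cauchy_schwarz M a b : possemidefmx M ->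
  bform M a b ^+ 2 <= qform M a * qform M b.
Proof.
move=> [sM M0].
have ha : 0 <= qform M b * (qform M a * qform M b - bform M a b ^+ 2).
  have := M0 (qform M b *: a + (- bform M a b) *: b).
  rewrite qformD // !qformZ bformZl bformZr; nra.
have hb : 0 <= qform M a * (qform M a * qform M b - bform M a b ^+ 2).
  have := M0 (qform M a *: b + (- bform M a b) *: a).
  rewrite qformD // !qformZ bformZl bformZr (bformC _ b a) //; nra.
have := M0 b; rewrite le_eqVlt => /orP[/eqP b0|b0]; last first.
  by move: ha; rewrite pmulr_rge0 // subr_ge0.
have := M0 a; rewrite le_eqVlt => /orP[/eqP a0|a0]; last first.
  by move: hb; rewrite pmulr_rge0 // subr_ge0.
(* Q vanishes at a and b: Q(a + b) and Q(a - b) are opposite, and nonnegative. *)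
have hp := M0 (a + b); have hm := M0 (a + (-1) *: b).
move: hp hm; rewrite !qformD // qformZ bformZr -a0 -b0 => hp hm.
suff -> : bform M a b = 0 by rewrite expr0n /= mul0r.
lra.
Qed.

Lemma psd_bform_le M a b : possemidefmx M ->
  bform M a b <= Num.sqrt (qform M a) * Num.sqrt (qform M b).
Proof.
move=> hM; have [sM M0] := hM.
rewrite -sqrtrM // (le_trans (ler_norm _)) // -sqrtr_sqr ler_wsqrtr //.
exact: psd_cauchy_schwarz.
Qed.

(** Triangle inequality for the vectors (a, sqrt k) and (b, 0): the constant k
    acts as one more coordinate.  It makes sqrt (Q + k), which is smooth when
    k > 0, Lipschitz for the seminorm sqrt Q. *)
Lemma psd_sqrt_qformD M a b k : possemidefmx M -> 0 <= k ->
  Num.sqrt (qform M (a + b) + k) <=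
  Num.sqrt (qform M a + k) + Num.sqrt (qform M b).
Proof.
move=> hM k0; have [sM M0] := hM.
rewrite -[leRHS]ger0_norm ?addr_ge0 ?sqrtr_ge0 // -sqrtr_sqr ler_wsqrtr //.
rewrite sqrrD !sqr_sqrtr ?addr_ge0 // qformD //.
have h := psd_bform_le M a b hM.
have h2 : Num.sqrt (qform M a) * Num.sqrt (qform M b) <=
    Num.sqrt (qform M a + k) * Num.sqrt (qform M b).
  by rewrite ler_wpM2r ?sqrtr_ge0 // ler_wsqrtr // lerDl.
by move: h h2; rewrite mulr2n; lra.
Qed.

Lemma possemidef1 : possemidefmx (1%:M : 'M[R]_n).
Proof.
split; first by rewrite trmx1.
move=> v; rewrite /qform mulmx1 mxE sumr_ge0 // => i _.
by rewrite mxE -expr2 sqr_ge0.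
Qed.

Lemma enormE v : enorm v = Num.sqrt (qform 1%:M v).
Proof.
rewrite /enorm /qform mulmx1 mxE; congr Num.sqrt; apply: eq_bigr => i _.
by rewrite mxE expr2.
Qed.

Lemma enorm_ge0 v : 0 <= enorm v. Proof. exact: sqrtr_ge0. Qed.

Lemma enorm_sqr v : enorm v ^+ 2 = qform 1%:M v.
Proof. by rewrite enormE sqr_sqrtr //; case: possemidef1. Qed.

Lemma enormD a b : enorm (a + b) <= enorm a + enorm b.
Proof.
have := @psd_sqrt_qformD 1%:M a b 0 possemidef1 (lexx 0).
by rewrite !addr0 -!enormE.
Qed.

Lemma enormN v : enorm (- v) = enorm v.
Proof. by rewrite !enormE qformN. Qed.

Lemma enormZ k v : enorm (k *: v) = `|k| * enorm v.
Proof. by rewrite !enormE qformZ sqrtrM ?sqr_ge0 // sqrtr_sqr. Qed.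

Lemma enorm_eq0 v : enorm v = 0 -> v = 0.
Proof.
move=> /(congr1 (fun k => k ^+ 2)); rewrite expr0n /= sqr_sqrtr; last first.
  by rewrite sumr_ge0 // => i _; rewrite sqr_ge0.
move/eqP; rewrite psumr_eq0 => [/allP h|i _]; last exact: sqr_ge0.
apply/colP => i; rewrite [RHS]mxE; apply/eqP.
by have := h i (mem_index_enum i); rewrite sqrf_eq0.
Qed.

Lemma enorm_cauchy_schwarz a b : bform 1%:M a b <= enorm a * enorm b.
Proof. by rewrite !enormE; apply: psd_bform_le; exact: possemidef1. Qed.

Lemma enorm_le k v : (forall i, `|v i 0| <= k) -> enorm v <= Num.sqrt n%:R * k.
Proof.
move=> hk; have [n0|n_gt0] := posnP n.
  rewrite /enorm big1 ?sqrtr0 => [|i _]; last by have := leq_trans (ltn_ord i) (eq_leq n0).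
  by rewrite n0 sqrtr0 mul0r.
have k0 : 0 <= k by apply: le_trans (hk (Ordinal n_gt0)).
rewrite -[X in _ * X]ger0_norm // -sqrtr_sqr -sqrtrM // ler_wsqrtr //.
rewrite mulr_natl -[X in _ *+ X]card_ord -sumr_const ler_sum // => i _.
by rewrite -real_normK ?num_real // lerXn2r ?nnegrE.
Qed.

Lemma enorm_le_norm v : enorm v <= Num.sqrt n%:R * `|v|.
Proof.
apply: enorm_le => i; rewrite [leRHS]/Num.Def.normr /= mx_normrE.
by apply: (le_bigmax _ (fun ij => `|v ij.1 ij.2|) (i, ord0)).
Qed.

End QuadraticForms.

(** * Operator norm *)

Section OperatorNorm.
Context {R : realType} {m n : nat}.
Implicit Type M : 'M[R]_(m, n).

Lemma enorm_mulmx_bounded M :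
  exists k : R, forall v : 'cV[R]_n, enorm v <= 1 -> enorm (M *m v) <= k.
Proof.
have coord_le1 (v : 'cV[R]_n) j : enorm v <= 1 -> `|v j 0| <= 1.
  move=> v1; apply: le_trans v1; rewrite -sqrtr_sqr ler_wsqrtr //.
  by rewrite (bigD1 j) //= lerDl sumr_ge0 // => i _; exact: sqr_ge0.
exists (Num.sqrt m%:R * \sum_i \sum_j `|M i j|) => v v1.
apply: enorm_le => i; rewrite mxE (le_trans (ler_norm_sum _ _ _)) //.
rewrite [leRHS](bigD1 i) //= -[leLHS]addr0 lerD //; last first.
  by rewrite sumr_ge0 // => k _; rewrite sumr_ge0.
by rewrite ler_sum // => j _; rewrite normrM ler_piMr // coord_le1.
Qed.

Lemma opnorm_unit_ball M (v : 'cV[R]_n) :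
  enorm v <= 1 -> enorm (M *m v) <= opnorm M.
Proof.
move=> v1; apply: ub_le_sup; last by exists v.
by have [k hk] := enorm_mulmx_bounded M; exists k => _ [w w1 <-]; exact: hk.
Qed.

Lemma opnorm_ge0 M : 0 <= opnorm M.
Proof.
apply: le_trans (enorm_ge0 (M *m 0)) (opnorm_unit_ball M 0 _).
by rewrite enormE qform0 sqrtr0.
Qed.

Lemma enorm_mulmx M (v : 'cV[R]_n) : enorm (M *m v) <= opnorm M * enorm v.
Proof.
have := enorm_ge0 v; rewrite le_eqVlt => /orP[/eqP /esym v0|v0].
  by rewrite v0 mulr0 (enorm_eq0 v v0) mulmx0 enormE qform0 sqrtr0.
have /opnorm_unit_ball : enorm ((enorm v)^-1 *: v) <= 1.
  by rewrite enormZ ger0_norm ?invr_ge0 ?enorm_ge0 // mulVf ?gt_eqF.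
move=> /(_ M); rewrite -scalemxAr enormZ ger0_norm ?invr_ge0 ?enorm_ge0 //.
by rewrite ler_pdivrMl // mulrC.
Qed.

End OperatorNorm.

(** * Extreme eigenvalues of symmetric matrices *)

Section Rayleigh.
Context {R : realType} {n : nat}.
Implicit Types (M P : 'M[R]_n) (v : 'cV[R]_n).

Lemma qform_le_opnorm M v : qform M v <= opnorm M * enorm v ^+ 2.
Proof.
have -> : qform M v = bform 1%:M v (M *m v).
  by rewrite /bform mulmx1 /qform mulmxA.
apply: le_trans (enorm_cauchy_schwarz _ _) _.
by rewrite mulrC expr2 mulrA ler_wpM2r ?enorm_ge0 // enorm_mulmx.
Qed.

(** By Cauchy-Schwarz for the form of M, |M v|^2 is at most a multiple of the
    form at v, and |v| is at most a multiple of |M v|. *)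
Lemma psd_unit_coercive M : possemidefmx M -> M \in unitmx ->
  exists2 k : R, 0 < k & forall v, k * enorm v ^+ 2 <= qform M v.
Proof.
move=> hM uM; have [sM M0] := hM.
set c := opnorm (invmx M) ^+ 2 * opnorm M.
have c0 : 0 <= c by rewrite mulr_ge0 ?sqr_ge0 ?opnorm_ge0.
exists (c + 1)^-1 => [|v]; first by rewrite invr_gt0; lra.
have Mv : enorm (M *m v) ^+ 2 <= opnorm M * qform M v.
  have := psd_cauchy_schwarz M v (M *m v) hM.
  have -> : bform M v (M *m v) = enorm (M *m v) ^+ 2.
    by rewrite enorm_sqr /qform /bform mulmx1 trmx_mul sM.
  move=> cs; have := qform_le_opnorm M (M *m v).
  set w := enorm (M *m v) in cs *; move: cs => cs w2.
  have := sqr_ge0 w; rewrite le_eqVlt => /orP[/eqP <-|w_gt0].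
    by rewrite mulr_ge0 ?opnorm_ge0.
  rewrite -(ler_pM2r w_gt0) -expr2 (le_trans cs) // mulrAC mulrC.
  by rewrite ler_wpM2r.
have v_le : enorm v <= opnorm (invmx M) * enorm (M *m v).
  by have := enorm_mulmx (invmx M) (M *m v); rewrite mulKmx.
rewrite ler_pdivrMl; last by lra.
apply: (@le_trans _ _ (c * qform M v)); last by have := M0 v; lra.
rewrite /c -mulrA (le_trans (y := opnorm (invmx M) ^+ 2 * enorm (M *m v) ^+ 2)) //.
  by rewrite -exprMn lerXn2r ?nnegrE ?mulr_ge0 ?enorm_ge0 ?opnorm_ge0.
by rewrite ler_wpM2l ?sqr_ge0.
Qed.

Lemma eigenvalueP_sym P (a : R) : P^T = P -> eigenvalue P a ->
  exists2 v : 'cV[R]_n, v != 0 & P *m v = a *: v.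
Proof.
move=> sP /eigenvalueP[w wP w0]; exists w^T; first by rewrite trmx_eq0.
by rewrite -{1}sP -trmx_mul wP linearZ.
Qed.

Lemma enorm_gt0 v : v != 0 -> 0 < enorm v.
Proof.
move=> v0; rewrite lt_def enorm_ge0 andbT; apply: contra v0 => /eqP.
by move=> /enorm_eq0 ->.
Qed.

Lemma qform_eigenvector P v (a : R) :
  P *m v = a *: v -> qform P v = a * enorm v ^+ 2.
Proof.
by move=> Pv; rewrite enorm_sqr /qform mulmx1 -mulmxA Pv -scalemxAr mxE.
Qed.

(** Let s be the supremum of the form on the unit sphere.  The form of s I - P is
    nonnegative, and it is not coercive, by the choice of s; so s I - P is
    singular, and s, which bounds every eigenvalue, is one of them. *)
Lemma lambda_maxP P : (0 < n)%N -> P^T = P ->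
  eigenvalue P (lambda_max P) /\
  forall v, qform P v <= lambda_max P * enorm v ^+ 2.
Proof.
move=> n_gt0 sP.
pose E := [set qform P v | v in [set v | enorm v = 1]].
pose s := sup E.
have unitE v : v != 0 -> E (qform P v / enorm v ^+ 2).
  move=> /enorm_gt0 v0; exists ((enorm v)^-1 *: v) => /=.
    by rewrite enormZ ger0_norm ?invr_ge0 ?enorm_ge0 // mulVf ?gt_eqF.
  by rewrite qformZ exprVn mulrC.
have ubE : has_ubound E.
  by exists (opnorm P) => _ [v /= v1 <-]; have := qform_le_opnorm P v;
    rewrite v1 expr1n mulr1.
have qs v : qform P v <= s * enorm v ^+ 2.
  have [->|v0] := eqVneq v 0; first by rewrite qform0 enormE qform0 sqrtr0 expr0n mulr0.
  rewrite -ler_pdivrMr ?exprn_gt0 ?enorm_gt0 //.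
  by apply: ub_le_sup => //; exact: unitE.
pose S := s%:M - P.
have qS v : qform S v = s * enorm v ^+ 2 - qform P v.
  rewrite enorm_sqr /qform /S mulmxBr mulmxBl mulmx1 mul_mx_scalar -scalemxAl.
  by rewrite !mxE.
have psdS : possemidefmx S.
  split => [|v]; last by rewrite qS subr_ge0.
  by rewrite /S linearB /= tr_scalar_mx sP.
have eigs : eigenvalue P s.
  case: (boolP (S \in unitmx)) => [uS|nuS].
    have [k k0 hk] := psd_unit_coercive _ psdS uS.
    have : s <= s - k.
      apply: ge_sup.
        exists (qform P (delta_mx (Ordinal n_gt0) 0) /
                enorm (delta_mx (Ordinal n_gt0) 0 : 'cV[R]_n) ^+ 2).
        apply: unitE; apply/negP => /eqP /colP /(_ (Ordinal n_gt0)).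
        by rewrite !mxE !eqxx => /eqP; rewrite oner_eq0.
      move=> _ [v /= v1 <-]; have := hk v; rewrite qS v1 expr1n; lra.
    lra.
  rewrite /eigenvalue /eigenspace kermx_eq0 row_free_unit -opprB -/S.
  by rewrite -scaleN1r unitmxZ // unitrN1.
have -> : lambda_max P = s.
  apply/eqP; rewrite eq_le; apply/andP; split.
    apply: ge_sup; first by exists s.
    move=> a /(eigenvalueP_sym _ _ sP)[v v0 /qform_eigenvector Pv].
    by have := qs v; rewrite Pv ler_pM2r // exprn_gt0 // enorm_gt0.
  apply: ub_le_sup => //; exists s.
  move=> a /(eigenvalueP_sym _ _ sP)[v v0 /qform_eigenvector Pv].
  by have := qs v; rewrite Pv ler_pM2r // exprn_gt0 // enorm_gt0.
by [].
Qed.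

(** Turns every statement on lambda_max into one on lambda_min. *)
Lemma lambda_minN P : lambda_min P = - lambda_max (- P).
Proof.
rewrite /lambda_min /inf; congr (- sup _); apply/seteqP.
have eN M a : eigenvalue M a -> eigenvalue (- M) (- a).
  move=> /eigenvalueP[w wM w0]; apply/eigenvalueP; exists w => //.
  by rewrite mulmxN wM scaleNr.
split=> [_ [a /eN h <-]//|a /eN]; rewrite /= opprK => h.
by exists (- a) => //; rewrite opprK.
Qed.

Lemma lambda_minP P : (0 < n)%N -> P^T = P ->
  eigenvalue P (lambda_min P) /\
  forall v, lambda_min P * enorm v ^+ 2 <= qform P v.
Proof.
move=> n_gt0 sP; have [] := lambda_maxP (- P) n_gt0.
  by rewrite linearN /= sP.
rewrite lambda_minN => /eigenvalueP[w wM w0] h; split.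
  apply/eigenvalueP; exists w => //.
  by rewrite scaleNr -wM mulmxN opprK.
move=> v; have := h v.
have -> : qform (- P) v = - qform P v by rewrite /qform mulmxN mulNmx mxE.
by rewrite mulNr; lra.
Qed.

Lemma sqrt_qform_le_lambda_max P v : (0 < n)%N -> P^T = P ->
  0 <= lambda_max P ->
  Num.sqrt (qform P v) <= Num.sqrt (lambda_max P) * enorm v.
Proof.
move=> n_gt0 sP l0; have [_ /(_ v) h] := lambda_maxP P n_gt0 sP.
rewrite -[enorm v]ger0_norm ?enorm_ge0 // -sqrtr_sqr -sqrtrM //.
exact: ler_wsqrtr.
Qed.

Lemma lambda_min_le_max P : (0 < n)%N -> P^T = P -> lambda_min P <= lambda_max P.
Proof.
move=> n_gt0 sP; have [/eigenvalueP_sym[//|v v0 /qform_eigenvector Pv] _] :=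
  lambda_minP P n_gt0 sP.
have [_ /(_ v)] := lambda_maxP P n_gt0 sP.
by rewrite Pv ler_pM2r // exprn_gt0 // enorm_gt0.
Qed.

Lemma posdef_lambda_min_gt0 P : (0 < n)%N -> posdefmx P -> 0 < lambda_min P.
Proof.
move=> n_gt0 [sP P0]; have [/eigenvalueP_sym[//|v v0 /qform_eigenvector Pv] _] :=
  lambda_minP P n_gt0 sP.
by have := P0 v v0; rewrite Pv pmulr_lgt0 // exprn_gt0 // enorm_gt0.
Qed.

Lemma posdef_possemidef P : posdefmx P -> possemidefmx P.
Proof.
move=> [sP P0]; split=> // v; have [->|/P0/ltW//] := eqVneq v 0.
by rewrite qform0.
Qed.

End Rayleigh.

(** * Real induction and absolutely continuous functions *)

Section RealInduction.
Context {R : realType}.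

(** A property that spreads from s to r along each elementary step reaches b as
    soon as every point t is crossed by all short enough steps: the supremum of
    the good points is then crossed, so it can only be b. *)
Lemma real_induction (a b : R) (good : set R) (step : R -> R -> Prop) :
  a <= b -> good a ->
  (forall s r, a <= s -> s <= r -> r <= b -> good s -> step s r -> good r) ->
  (forall t, a <= t <= b -> exists2 d, 0 < d &
     forall s r, a <= s -> s <= t -> t <= r -> r <= b ->
       t - d < s -> r < t + d -> step s r) ->
  good b.
Proof.
move=> ab ga ext loc.
pose E := [set t | a <= t <= b /\ good t].
have Ea : E a by rewrite /E /= lexx ab.
have supE : has_sup E by split; [exists a|exists b => t [/andP[]]].
have t_itv : a <= sup E <= b.
  apply/andP; split; first by apply: ub_le_sup => //; case: supE.
  by apply: ge_sup; [exists a|move=> t [/andP[]]].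
have [d d0 hd] := loc _ t_itv.
have [s [/andP[sa sb] gs] ts] := sup_adherent d0 supE.
have st : s <= sup E by apply: ub_le_sup => //; [case: supE|rewrite /E /= sa].
move: t_itv => /andP[at_ tb].
pose r := Num.min b (sup E + d / 2).
have tr : sup E <= r by rewrite /r le_min tb /=; lra.
have rb : r <= b by rewrite /r ge_min lexx.
have rd : r < sup E + d by rewrite /r gt_min; apply/orP; right; lra.
have gr : good r.
  by apply: (ext s r) => //; [exact: le_trans tr|exact: hd].
have : r <= sup E.
  by apply: ub_le_sup; [case: supE|split=> //; rewrite rb andbT (le_trans at_)].
by move: gr tr; rewrite /r minElt; case: ifP => // _ _ _; lra.
Qed.

End RealInduction.

Section AbsolutelyContinuous.
Context {R : realType}.

(** The step may start before t and end after t: the difference quotients on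
    the two sides of t are bounded separately and added. *)
Lemma derivative_le0_growth (g : R -> R) (t dg eps : R) :
  is_derive t (1 : R) g dg -> dg <= 0 -> 0 < eps ->
  exists2 d, 0 < d & forall s r, s <= t -> t <= r -> t - d < s -> r < t + d ->
    g r - g s <= eps * (r - s).
Proof.
move=> [dgt <-] dg0 eps0.
have := dgt; rewrite /derivable => /cvg_ex[l hl].
have l0 : l <= 0 by move: dg0; rewrite /derive (cvg_lim _ hl).
have [d /= d0 hd] : \forall h \near 0^', `|l - h^-1 *: ((g \o shift t) (h *: 1) - g t)| < eps.
  by move/cvgrPdist_lt : hl => /(_ _ eps0).
have quot h : h != 0 -> `|h| < d -> h^-1 * (g (h + t) - g t) < eps.
  move=> h0 hlt; have := hd h; rewrite /= sub0r normrN => /(_ hlt h0).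
  rewrite ltr_norml => /andP[hq _].
  have {hq} : - eps < l - h^-1 * (g (h * 1 + t) - g t) by [].
  by rewrite mulr1; lra.
have right r : t <= r -> r < t + d -> g r - g t <= eps * (r - t).
  rewrite le_eqVlt => /orP[/eqP <- _|tr rd]; first by rewrite !subrr mulr0.
  have := quot (r - t); rewrite subrK ltr_pdivrMl ?subr_gt0 // mulrC => h.
  by apply/ltW/h; [rewrite subr_eq0 gt_eqF|rewrite ger0_norm; lra].
have left s : s <= t -> t - d < s -> g t - g s <= eps * (t - s).
  rewrite le_eqVlt => /orP[/eqP -> _|st sd]; first by rewrite !subrr mulr0.
  have := quot (s - t); rewrite subrK ltr_ndivrMl ?subr_lt0 // => h.
  have {h} : (s - t) * eps < g s - g t.
    by apply: h; [rewrite subr_eq0 lt_eqF|rewrite ltr0_norm; lra].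
  nra.
exists d => // s r st tr sd rd.
by have := left s st sd; have := right r tr rd; nra.
Qed.

(** Real induction covers the interval by steps of two kinds: around a point
    where the derivative is at most 0, g grows by at most eps times the length
    of the step; the other points lie in an open set of small measure, and the
    steps inside it add up to little by absolute continuity. *)
Lemma abs_continuous_nonincreasing (g : R -> R) (a b : R) :
  0 <= a -> a <= b -> loc_abs_continuous g ->
  {ae (@lebesgue_measure R), forall t : R, a <= t <= b ->
     exists2 dg, dg <= 0 & is_derive t (1 : R) g dg} ->
  g b <= g a.
Proof.
move=> a0 ab acg [N [mN N0 badN]].
have {}N0 : @lebesgue_measure R N = 0%E by exact: N0.
apply/ler_addgt0Pr => e e0.
pose eps := e / (2 * (b - a + 1)).
have eps0 : 0 < eps by rewrite divr_gt0 //; lra.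
have epsE : eps * (b - a) <= e / 2.
  by rewrite /eps mulrAC ler_pdivrMr; [nra|lra].
have e20 : 0 < e / 2 by lra.
have [d d0 acd] := acg a b (e / 2) a0 ab e20.
have [U [oU NU muU]] : exists U : set R, [/\ open U, N `<=` U &
    (lebesgue_measure U < d%:E)%E].
  have [|U [oU NU muU]] := lebesgue_regularity_outer mN _ d0.
    by rewrite [X in (X < _)%E]N0.
  exists U; split=> //.
  have mU : measurable U by exact: measurable_realfun.open_measurable.
  rewrite -(setDUK NU) measureU //; last by rewrite setDIK.
    apply: le_lt_trans muU; rewrite -[leRHS]add0e; apply: leeD => //.
    by rewrite le_eqVlt; apply/orP; left; apply/eqP; exact: N0.
  exact: measurableD.
(* The intervals ]s i, r i[ record the steps made inside U on the way from a to
   t; they are listed from left to right, hence disjoint. *)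
pose cover (t : R) (m : nat) (s r : nat -> R) :=
  [/\ forall i, (i < m)%N -> [/\ a <= s i, s i <= r i & r i <= t],
      forall i, (i < m)%N -> `]s i, r i[ `<=` U,
      forall i j, (i < j)%N -> (j < m)%N -> r i <= s j &
      g t <= g a + eps * (t - a) + \sum_(i < m) `|g (r i) - g (s i)|].
pose good := [set t | exists m s r, cover t m s r].
pose step (s r : R) := g r - g s <= eps * (r - s) \/ `]s, r[ `<=` U.
have [m [s [r [sr srU dis gb]]]] : good b.
  apply: (@real_induction R a b good step) => //.
  - exists 0%N, (fun=> 0), (fun=> 0); split=> //.
    by rewrite big_ord0 subrr mulr0 !addr0.
  - move=> s r as_ sr rb [m [s' [r' [h1 h2 h3 h4]]]] [hs|hs].
      exists m, s', r'; split=> //; last by nra.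
      by move=> i /h1[? ? ?]; split=> //; exact: le_trans sr.
    exists m.+1, (fun i => if (i < m)%N then s' i else s),
      (fun i => if (i < m)%N then r' i else r); split.
    + move=> i; case: ifP => [im _|_ _]; last by [].
      by have [? ? ?] := h1 i im; split=> //; exact: le_trans sr.
    + by move=> i; case: ifP => [im _|_ _]; [exact: h2|].
    + move=> i j ij jm1; have im : (i < m)%N by exact: leq_trans ij _.
      rewrite im; case: ifP => [jm|_]; first exact: h3.
      by have [] := h1 i im.
    + rewrite big_ord_recr /= ltnn.
      under eq_bigr do rewrite ltn_ord.
      have := ler_norm (g r - g s); have := mulr_ge0 (ltW eps0) (_ : 0 <= r - s).
      rewrite subr_ge0 => /(_ sr); nra.
  - move=> t tab; have [Nt|nNt] := pselect (N t).
      have : nbhs t U by apply: open_nbhs_nbhs; split=> //; exact: NU.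
      move=> [d' /= d'0 hd']; exists d' => // s r _ st tr _ sd rd; right.
      move=> w /=; rewrite in_itv /= => /andP[sw wr]; apply: hd' => /=.
      by rewrite ltr_norml; apply/andP; split; lra.
    have [dg dg0 dgt] : exists2 dg, dg <= 0 & is_derive t (1 : R) g dg.
      by apply: contrapT => h; apply: nNt; apply: badN => /= /(_ tab).
    have [d' d'0 hd'] := derivative_le0_growth g t dg eps dgt dg0 eps0.
    by exists d' => // s r _ st tr _ sd rd; left; exact: hd'.
suff : \sum_(i < m) `|g (r i) - g (s i)| < e / 2 by lra.
have tI : trivIset setT (fun i : 'I_m => `]s i, r i[%classic).
  apply/trivIsetP => i j _ _ ij; apply/seteqP; split=> // w [] /=.
  rewrite !in_itv /= => /andP[siw wri] /andP[sjw wrj].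
  have [lij|lji|/val_inj eij] := ltngtP i j.
  - by have := dis i j lij (ltn_ord j); lra.
  - by have := dis j i lji (ltn_ord i); lra.
  - by rewrite eij eqxx in ij.
apply: acd => //.
- by move=> i; exact: sr.
have itvE (i : 'I_m) : (r i - s i)%:E = lebesgue_measure `]s i, r i[%classic.
  have [_ sri _] := sr i (ltn_ord i); rewrite lebesgue_measure_itv /= lte_fin.
  case: ltP => [_|rsi]; first by rewrite EFinB.
  by congr EFin; lra.
rewrite -lte_fin; apply: le_lt_trans muU; rewrite -sumEFin.
under eq_bigr do rewrite itvE.
rewrite -measure_bigsetU_ord //.
apply: le_measure; rewrite ?inE.
- by apply: bigsetU_measurable.
- exact: measurable_realfun.open_measurable.
- elim/big_ind : _ => [//|V V' VU V'U w [/VU|/V'U]//|i _]; exact: srU.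
Qed.

End AbsolutelyContinuous.

(** * The Gronwall inequality *)

Section Gronwall.
Context {R : realType}.

Lemma loc_abs_continuous_id : loc_abs_continuous (id : R -> R).
Proof.
move=> a b eps a0 ab eps0; exists eps => // N s t st _ sum_lt.
rewrite (le_lt_trans _ sum_lt) // ler_sum // => i _.
by have [_ ? _] := st i; rewrite ger0_norm ?subr_ge0.
Qed.

(** A single closure property covers both uses: Lipschitz functions of the two
    trajectories, and products with a smooth function of time. *)
Lemma loc_abs_continuous_dominated (U V W : normedModType R)
    (g : R -> U) (x : R -> V) (y : R -> W) :
  loc_abs_continuous x -> loc_abs_continuous y ->
  (forall b, 0 <= b -> exists2 M, 0 < M & forall s t, 0 <= s -> s <= t ->
     t <= b -> `|g t - g s| <= M * (`|x t - x s| + `|y t - y s|)) ->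
  loc_abs_continuous g.
Proof.
move=> acx acy dom a b eps a0 ab eps0.
have [M M0 hM] := dom b (le_trans a0 ab).
have eM : 0 < eps / M / 2 by rewrite !divr_gt0.
have [dx dx0 hx] := acx a b _ a0 ab eM.
have [dy dy0 hy] := acy a b _ a0 ab eM.
exists (Num.min dx dy) => [|N s t st tI]; first by rewrite lt_min dx0.
rewrite lt_min => /andP[sx sy].
apply: (@le_lt_trans _ _
  (M * (\sum_i `|x (t i) - x (s i)| + \sum_i `|y (t i) - y (s i)|))).
  rewrite -big_split mulr_sumr /= ler_sum // => i _.
  by have [as_ le_st tb] := st i; apply: hM => //; exact: le_trans as_.
rewrite mulrC -ltr_pdivlMr // [ltRHS](splitr (eps / M)).
by rewrite ltrD ?hx ?hy.
Qed.

(** Steps of length d / 2, where d is the modulus of continuity at 1, cover the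
    interval, and g varies by less than 1 over each of them. *)
Lemma loc_abs_continuous_bounded (g : R -> R) (b : R) :
  0 <= b -> loc_abs_continuous g ->
  exists2 M, 0 <= M & forall t, 0 <= t <= b -> `|g t| <= M.
Proof.
move=> b0 acg; have [d d0 hd] := acg 0 b 1 (lexx 0) b0 ltr01.
have osc s t : 0 <= s -> s <= t -> t <= b -> t - s < d -> `|g t - g s| < 1.
  move=> s0 st tb std.
  have := hd 1%N (fun=> s) (fun=> t); rewrite !big_ord1; apply=> //.
  by apply/trivIsetP => i j _ _; rewrite !ord1 eqxx.
have steps (k : nat) t : 0 <= t -> t <= b -> t <= k%:R * (d / 2) ->
    `|g t| <= `|g 0| + k%:R.
  elim: k t => [|k IH] t t0 tb; rewrite ?mul0r ?addr0 => tk.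
    by have -> : t = 0 by lra.
  pose s := Num.max 0 (t - d / 2).
  have s0 : 0 <= s by rewrite le_max lexx.
  have st : s <= t by rewrite ge_max t0 /=; lra.
  have ts : t - s < d by have : t - d / 2 <= s by [rewrite le_max lexx orbT]; lra.
  have sk : s <= k%:R * (d / 2).
    rewrite ge_max mulr_ge0 /=; [|by []|lra].
    by move: tk; rewrite -natr1; lra.
  have := IH s s0 (le_trans st tb) sk; have := osc s t s0 st tb ts.
  have := ler_normD (g t - g s) (g s); rewrite subrK -natr1; lra.
have bd0 : 0 <= b / (d / 2) by rewrite divr_ge0 //; lra.
exists (`|g 0| + (Num.bound (b / (d / 2)))%:R) => [|t /andP[t0 tb]].
  by rewrite addr_ge0.
apply: steps => //; apply: le_trans tb _.
by rewrite -ler_pdivrMr ?ltW ?archi_boundP //; lra.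
Qed.

Lemma expR_increment_le (a b : R) : a <= b ->
  0 <= expR b - expR a <= expR b * (b - a).
Proof.
move=> ab; rewrite subr_ge0 ler_expR ab /=.
have -> : expR a = expR b * expR (a - b) by rewrite -expRD; congr expR; lra.
have := expR_ge1Dx (a - b); have := expR_gt0 b; nra.
Qed.

(** The function exp (rho t) m t is absolutely continuous and its derivative is
    nonpositive almost everywhere. *)
Lemma abs_continuous_gronwall (m : R -> R) (rho T0 : R) :
  0 <= rho -> 0 <= T0 -> loc_abs_continuous m ->
  {ae (@lebesgue_measure R), forall t : R, T0 <= t ->
     exists2 dm, dm <= - rho * m t & is_derive t (1 : R) m dm} ->
  forall t, T0 <= t -> m t <= expR (- rho * (t - T0)) * m T0.
Proof.
move=> rho0 T00 acm dm_le t T0t.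
pose g s := expR (rho * s) * m s.
suff : g t <= g T0.
  have -> : - rho * (t - T0) = rho * T0 - rho * t by ring.
  by rewrite expRD expRN mulrAC ler_pdivlMr ?expR_gt0 // mulrC.
apply: abs_continuous_nonincreasing => //.
  apply: (loc_abs_continuous_dominated _ _ _ _ _ _ acm loc_abs_continuous_id).
  move=> b b0; have [M M0 hM] := loc_abs_continuous_bounded m b b0 acm.
  exists (expR (rho * b) * (1 + M * rho)) => [|s r s0 sr rb].
    by rewrite mulr_gt0 ?expR_gt0 //; have := mulr_ge0 M0 rho0; lra.
  rewrite (ger0_norm (_ : 0 <= r - s)) ?subr_ge0 //.
  have -> : g r - g s = expR (rho * r) * (m r - m s) +
      m s * (expR (rho * r) - expR (rho * s)) by rewrite /g; ring.
  have /andP[E0 E1] := expR_increment_le _ _ (ler_wpM2l rho0 sr).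
  have Erb : expR (rho * r) <= expR (rho * b) by rewrite ler_expR ler_wpM2l.
  have ms : `|m s| <= M by apply: hM; rewrite s0 (le_trans sr).
  rewrite (le_trans (ler_normD _ _)) // !normrM (ger0_norm E0).
  rewrite (ger0_norm (expR_ge0 _)).
  have h1 : expR (rho * r) * `|m r - m s| <= expR (rho * b) * `|m r - m s|.
    by rewrite ler_wpM2r.
  have h2 : `|m s| * (expR (rho * r) - expR (rho * s)) <=
      M * (expR (rho * b) * (rho * (r - s))).
    apply: ler_pM => //; apply: le_trans E1 _; rewrite -mulrBr.
    by rewrite ler_wpM2r // mulr_ge0 // subr_ge0.
  have h3 : 0 <= expR (rho * b) * (r - s).
    by rewrite mulr_ge0 ?expR_ge0 // subr_ge0.
  have h4 : 0 <= expR (rho * b) * (M * rho) * `|m r - m s|.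
    by rewrite !mulr_ge0 ?expR_ge0.
  rewrite /= in h1 h2 h3 h4 *; lra.
have F := ae_filter_ringOfSetsType (@lebesgue_measure R).
apply: filterS dm_le => s hs /andP[/hs[dm dm_le dms] _].
exists (expR (rho * s) * (dm + rho * m s)).
  by rewrite mulr_ge0_le0 ?expR_ge0 //; lra.
have dE : is_derive s (1 : R) (fun r => expR (rho * r)) (expR (rho * s) * rho).
  have dl : is_derive s (1 : R) (fun r => rho * r) rho.
    by have := is_deriveZ rho (is_derive_id s (1 : R)); rewrite [rho *: 1]mulr1.
  exact: (is_derive1_comp (is_derive_expR _) dl).
apply: (is_derive_eq (is_deriveM dE dms)).
transitivity (expR (rho * s) * dm + m s * (expR (rho * s) * rho)); first by [].
by ring.
Qed.

End Gronwall.

(** * Decay of a Lyapunov function *)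

Section Lyapunov.
Context {R : realType} {n : nat}.
Implicit Type P : 'M[R]_n.

Lemma is_derive_coord (e : R -> 'cV[R]_n) (t : R) (de : 'cV[R]_n) i :
  is_derive t (1 : R) e de -> is_derive t (1 : R) (fun s => e s i 0) (de i 0).
Proof.
move=> [dere <-]; have /derivable_mxP /(_ i 0) h := dere.
by rewrite (derive_mx dere) mxE; exact: derivableP.
Qed.

Lemma is_derive_qform P (e : R -> 'cV[R]_n) (t : R) (de : 'cV[R]_n) :
  P^T = P -> is_derive t (1 : R) e de ->
  is_derive t (1 : R) (fun s => qform P (e s)) (2 * bform P (e t) de).
Proof.
move=> sP de_e; pose c i := fun s => e s i 0.
have dc i : is_derive t (1 : R) (c i) (de i 0) := is_derive_coord e t de i de_e.
have -> : (fun s => qform P (e s)) =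
    \sum_(j < n) (\sum_(i < n) P i j *: c i) * c j.
  apply/funext => s; rewrite fct_sumE /qform mxE; apply: eq_bigr => j _.
  rewrite [RHS]/(_ * _) fct_sumE mxE; congr (_ * _).
  by apply: eq_bigr => i _; rewrite mxE mulrC.
apply: (is_derive_eq (is_derive_sum (fun j => is_deriveM
  (is_derive_sum (fun i => is_deriveZ (P i j) (dc i))) (dc j)))).
have -> : 2 * bform P (e t) de = bform P (e t) de + bform P de (e t).
  by rewrite [bform P de _]bformC //; ring.
rewrite /bform !mxE -big_split; apply: eq_bigr => j _.
rewrite /= fct_sumE !mxE; congr (_ + _).
  by congr (_ * _); apply: eq_bigr => i _; rewrite mxE mulrC.
rewrite [LHS]mulrC; congr (_ * _).
by apply: eq_bigr => i _; rewrite mxE mulrC.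
Qed.

(** The function sqrt Q is not differentiable where Q vanishes; the proof works
    with sqrt (Q + eta^2), which decays at the same rate up to an error of
    order eta, and lets eta tend to 0. *)
Lemma lyapunov_decay P (x xh : R -> 'cV[R]_n) (rho c T0 : R) :
  possemidefmx P -> 0 < rho -> 0 <= c -> 0 <= T0 ->
  loc_abs_continuous x -> loc_abs_continuous xh ->
  let e := fun t => xh t - x t in
  {ae (@lebesgue_measure R), forall t : R, T0 <= t ->
     exists2 de, is_derive t (1 : R) e de &
       bform P (e t) de <=
         - rho * qform P (e t) + c * Num.sqrt (qform P (e t))} ->
  forall t, T0 <= t ->
    Num.sqrt (qform P (e t)) <=
      expR (- rho * (t - T0)) * Num.sqrt (qform P (e T0)) + c / rho.
Proof.
move=> psdP rho0 c0 T00 acx acxh e decay t T0t; have [sP P0] := psdP.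
apply/ler_addgt0Pr => eps eps0; pose eta := eps / 2.
have eta0 : 0 < eta by rewrite /eta; lra.
pose w v := Num.sqrt (qform P v + eta ^+ 2).
have eta2 : 0 < eta ^+ 2 by rewrite exprn_gt0.
have w0 v : 0 < w v by rewrite sqrtr_gt0 ltr_wpDl.
have w2 v : w v ^+ 2 = qform P v + eta ^+ 2.
  by rewrite sqr_sqrtr // addr_ge0 // ltW.
have le_w v : Num.sqrt (qform P v) <= w v by rewrite ler_wsqrtr // lerDl ltW.
have w_le v : w v <= Num.sqrt (qform P v) + eta.
  have := @psd_sqrt_qformD _ _ P 0 v (eta ^+ 2) psdP (ltW eta2).
  by rewrite add0r qform0 add0r sqrtr_sqr gtr0_norm // -/(w v); lra.
have eta_w v : eta <= w v.
  by rewrite -(gtr0_norm eta0) -sqrtr_sqr ler_wsqrtr // lerDr.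
(* The equilibrium of w' = - rho w + rho eta + c, the equation that bounds the
   growth of w along e. *)
pose k := eta + c / rho; pose m s := w (e s) - k.
suff : m t <= expR (- rho * (t - T0)) * m T0.
  have E1 : expR (- rho * (t - T0)) <= 1.
    by rewrite -expR0 ler_expR; have : 0 <= t - T0 by [lra]; nra.
  have E0 := expR_gt0 (- rho * (t - T0)).
  have cr : 0 <= c / rho by rewrite divr_ge0 // ltW.
  have := le_w (e t); have := w_le (e T0).
  rewrite /m /k; set w1 := w (e T0); set s1 := Num.sqrt _; set E := expR _.
  rewrite -/E in E0 E1 *.
  have -> : eps = 2 * eta by rewrite /eta; lra.
  have := sqrtr_ge0 (qform P (e T0)); rewrite -/s1 => s10.
  move=> h1 h2 h3.
  have : E * (w1 - (eta + c / rho)) <= E * s1.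
    by rewrite ler_pM2l //; lra.
  lra.
apply: abs_continuous_gronwall => //; first exact: ltW.
  apply: (loc_abs_continuous_dominated _ _ _ _ _ _ acx acxh) => b b0.
  pose K := Num.sqrt (opnorm P) * Num.sqrt n%:R.
  have K0 : 0 <= K by rewrite mulr_ge0 ?sqrtr_ge0.
  exists (K + 1) => [|s r s0 sr rb]; first by lra.
  have sqrtQ v : Num.sqrt (qform P v) <= K * `|v|.
    apply: (@le_trans _ _ (Num.sqrt (opnorm P) * enorm v)).
      rewrite -[enorm v]ger0_norm ?enorm_ge0 // -sqrtr_sqr -sqrtrM ?opnorm_ge0 //.
      by rewrite ler_wsqrtr // qform_le_opnorm.
    by rewrite /K -mulrA ler_wpM2l ?sqrtr_ge0 // enorm_le_norm.
  have osc p q : w (e p) - w (e q) <= K * `|e p - e q|.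
    have := @psd_sqrt_qformD _ _ P (e q) (e p - e q) (eta ^+ 2) psdP (ltW eta2).
    rewrite subrKC -/(w (e p)) -/(w (e q)); have := sqrtQ (e p - e q); lra.
  have -> : m r - m s = w (e r) - w (e s) by rewrite /m; ring.
  apply: (@le_trans _ _ (K * `|e r - e s|)).
    rewrite ler_norml osc andbT.
    by have := osc s r; rewrite distrC; lra.
  have : `|e r - e s| <= `|x r - x s| + `|xh r - xh s|.
    rewrite /e opprD opprK addrACA (le_trans (ler_normD _ _)) //.
    by rewrite [leRHS]addrC [- x r + _]addrC (distrC (x s)).
  have := normr_ge0 (x r - x s); have := normr_ge0 (xh r - xh s).
  rewrite mulrDl mul1r => h1 h2 h3.
  have := ler_wpM2l K0 h3; lra.
have F := ae_filter_ringOfSetsType (@lebesgue_measure R).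
apply: filterS decay => s hs /hs[de de_e de_le].
exists ((2 * w (e s))^-1 * (2 * bform P (e s) de)); last first.
  have dQ := is_derive_qform P e s de sP de_e.
  have dQe : is_derive s (1 : R) (fun r => qform P (e r) + eta ^+ 2)
      (2 * bform P (e s) de).
    have := is_deriveD dQ (is_derive_cst (eta ^+ 2) s (1 : R)).
    by rewrite addr0.
  have Q0 : 0 < qform P (e s) + eta ^+ 2 by rewrite ltr_wpDl.
  have dw := @is_derive1_comp R Num.sqrt (fun r => qform P (e r) + eta ^+ 2) s
    _ _ (is_derive1_sqrt Q0) dQe.
  have := is_deriveB dw (is_derive_cst k s (1 : R)).
  by rewrite subr0.
have -> : (2 * w (e s))^-1 * (2 * bform P (e s) de) = bform P (e s) de / w (e s).
  by field; rewrite gt_eqF.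
rewrite ler_pdivrMr // (le_trans de_le) //.
have h1 : c * Num.sqrt (qform P (e s)) <= c * w (e s) by rewrite ler_wpM2l.
have h2 : qform P (e s) = w (e s) ^+ 2 - eta ^+ 2 by rewrite w2 addrK.
have -> : - rho * m s * w (e s) =
    - rho * w (e s) ^+ 2 + rho * eta * w (e s) + c * w (e s).
  by rewrite /m /k; field; rewrite gt_eqF.
have h3 : rho * eta * eta <= rho * eta * w (e s).
  by rewrite ler_wpM2l // mulr_ge0 ?ltW.
by rewrite {1}h2; lra.
Qed.

End Lyapunov.

(** * The matrix inequality and the error dynamics *)

Section Dissipation.
Context {R : realType} {n : nat}.
Implicit Types (M N P : 'M[R]_n) (a b v : 'cV[R]_n).

Lemma bform_diag (d : 'rV[R]_n) a b :
  bform (diag_mx d) a b = \sum_i d 0 i * a i 0 * b i 0.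
Proof.
rewrite /bform mxE; apply: eq_bigr => i _.
by rewrite mul_mx_diag !mxE [a i 0 * _]mulrC.
Qed.

Lemma qform_block_sym M11 M12 M22 a b :
  qform (block_mx M11 M12 M12^T M22) (col_mx a b) =
  qform M11 a + 2 * bform M12 a b + qform M22 b.
Proof.
rewrite /qform tr_col_mx mul_row_block mul_row_col !mulmxDl !mxE.
have -> : \sum_j (b^T *m M12^T) 0 j * a j 0 = bform M12 a b.
  by rewrite -bform_tr /bform mxE.
have -> : \sum_j (a^T *m M12) 0 j * b j 0 = bform M12 a b.
  by rewrite /bform mxE.
ring.
Qed.

(** The S-procedure: at the vector (e, delta) the blocks that contain gam and
    lam contribute -2 times the left-hand side of the sector inequality, which
    is nonnegative and can be dropped. *)
Lemma lmi_dissipation P (F G : 'M[R]_n) (gam lam : 'rV[R]_n) (q : R)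
    (e delta : 'cV[R]_n) :
  (forall w, qform (block_mx (He (P *m F) + q *: 1%:M)
       (P *m G + diag_mx gam *m diag_mx lam)
       (P *m G + diag_mx gam *m diag_mx lam)^T (- (2 *: diag_mx lam))) w <= 0) ->
  \sum_i lam 0 i * delta i 0 * (delta i 0 - gam 0 i * e i 0) <= 0 ->
  bform P e (F *m e + G *m delta) <= - (q / 2) * enorm e ^+ 2.
Proof.
move=> /(_ (col_mx e delta)) + sec; rewrite qform_block_sym bformDr.
have -> : qform (He (P *m F) + q *: 1%:M) e =
    2 * bform P e (F *m e) + q * enorm e ^+ 2.
  rewrite enorm_sqr !qformE /He !bform_mxD bform_tr bform_mulmx.
  by rewrite bform_mxZ; ring.
have -> : qform (- (2 *: diag_mx lam)) delta =
    - (2 * \sum_i lam 0 i * delta i 0 * delta i 0).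
  by rewrite -bform_diag qformE -scaleN1r !bform_mxZ mulN1r.
rewrite bform_mxD bform_mulmx.
have -> : bform (diag_mx gam *m diag_mx lam) e delta =
    \sum_i lam 0 i * delta i 0 * delta i 0 -
    \sum_i lam 0 i * delta i 0 * (delta i 0 - gam 0 i * e i 0).
  rewrite mulmx_diag bform_diag -sumrB; apply: eq_bigr => i _.
  by rewrite mxE; ring.
lra.
Qed.

End Dissipation.

(** The measured output and the reconstructed signal differ from C x and from
    C (A x + W f x) by v and eps only, so in the error dynamics the
    terms in x cancel up to differences. *)
Lemma error_field (R : realType) (n nu ny : nat) (A W : 'M[R]_n)
    (B : 'M[R]_(n, nu)) (C : 'M[R]_(ny, n)) (K K' : 'M[R]_(n, ny))
    (f : 'cV[R]_n -> 'cV[R]_n) (u : R -> 'cV[R]_nu) (p : R -> 'cV[R]_n)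
    (y zh2 : R -> 'cV[R]_ny) (t : R) (x xh : 'cV[R]_n) (v eps : 'cV[R]_ny) :
  y t = C *m x + v -> zh2 t = C *m A *m x + C *m W *m f x + eps ->
  observer_field A W B C K K' f u y zh2 t xh - lure_field A W B f u p t x =
  (((1%:M - K' *m C) *m A - K *m C) *m (xh - x) +
    ((1%:M - K' *m C) *m W) *m (f xh - f x)) + (K *m v + K' *m eps - p t).
Proof.
move=> yE zE; rewrite /observer_field /lure_field yE zE.
rewrite !(mulmxBl, mulmxBr, mulmxDl, mulmxDr, mulmxN, mulNmx, mul1mx, mulmxA).
apply/colP => i.
move: (A *m xh) (A *m x) (W *m f xh) (W *m f x) (B *m u t) (K *m v)
  (K' *m eps) (K *m C *m x) (K *m C *m xh) (K' *m C *m A *m x)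
  (K' *m C *m A *m xh) (K' *m C *m W *m f x) (K' *m C *m W *m f xh) (p t).
by move=> *; rewrite !mxE; ring.
Qed.

Theorem proposition15 (R : realType) (n nu ny : nat) (n_gt0 : (0 < n)%N)
  (A W : 'M[R]_n) (B : 'M[R]_(n, nu)) (C : 'M[R]_(ny, n))
  (f : 'cV[R]_n -> 'cV[R]_n) (f_C1 : C1 f) (f_lip : elipschitz f)
  (u : R -> 'cV[R]_nu) (p : R -> 'cV[R]_n) (v : R -> 'cV[R]_ny)
  (pbar vbar : R)
  (p_bound : forall t, 0 <= t -> enorm (p t) <= pbar)
  (v_bound : forall t, 0 <= t -> enorm (v t) <= vbar)
  (x : R -> 'cV[R]_n) (y : R -> 'cV[R]_ny)
  (x_sol : caratheodory_solution (lure_field A W B f u p) x)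
  (y_def : forall t, 0 <= t -> y t = C *m x t + v t)
  (L : 'I_ny -> R) (k1 k2 : R)
  (L_gt0 : forall j, 0 < L j) (k1_gt0 : 0 < k1) (k2_gt0 : 0 < k2)
  (z : 'I_ny -> R -> R * R)
  (z_sol : forall j, filippov_solution
     (smo_field (L j) k1 k2 (fun t => (C *m B *m u t) j 0) (fun t => y t j 0))
     (z j))
  (K K' : 'M[R]_(n, ny)) (xh : R -> 'cV[R]_n)
  (xh_sol : caratheodory_solution
     (observer_field A W B C K K' f u y (fun t => \col_j (z j t).2)) xh)
  (P : 'M[R]_n) (gam lam : 'rV[R]_n) (q : R)
  (P_pd : posdefmx P)
  (Gamma_psd : possemidefmx (diag_mx gam))
  (Lambda_pd : posdefmx (diag_mx lam))
  (sector : incremental_sector f gam lam)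
  (q_gt0 : 0 < q)
  (lmi : let AK' := (1%:M - K' *m C) *m A in
         let WK' := (1%:M - K' *m C) *m W in
         let S := P *m WK' + diag_mx gam *m diag_mx lam in
         negsemidefmx
           (block_mx (He (P *m (AK' - K *m C)) + q *: 1%:M) S
                     S^T                                    (- (2 *: diag_mx lam))))
  (c0 c1 : ('I_ny -> R) -> R)
  (c0_ge0 : forall L', (forall j, 0 < L' j) -> 0 <= c0 L')
  (c1_ge0 : forall L', (forall j, 0 < L' j) -> 0 <= c1 L')
  (c0_bigO : gain_bigO c0 (fun L' => \big[Num.max/0]_j L' j))
  (c1_bigO : gain_bigO c1 (fun=> 1))
  (T0 : R) (T0_ge0 : 0 <= T0) (eps2 : 'I_ny -> R -> R)
  (z2_rec : forall t j, T0 <= t ->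
     (z j t).2 = (C *m A *m x t + C *m W *m f (x t)) j 0 + eps2 j t)
  (eps2_bound : forall t j, T0 <= t ->
     `|eps2 j t| <= c0 L * Num.sqrt vbar + c1 L * pbar) :
  let eps2bar := Num.sqrt ny%:R * (c0 L * Num.sqrt vbar + c1 L * pbar) in
  let kappaP := Num.sqrt (lambda_max P / lambda_min P) in
  let rho := q / (2 * lambda_max P) in
  let e := fun t => xh t - x t in
  forall t, T0 <= t ->
    enorm (e t) <=
      kappaP * (expR (- rho * (t - T0)) * enorm (e T0)
                + 1 / rho * (opnorm K * vbar + opnorm K' * eps2bar + pbar)).
Proof.
move=> eps2bar kappaP rho e t T0t.
have [acx dx] := x_sol; have [acxh dxh] := xh_sol; have [sP P0] := P_pd.
have psdP := posdef_possemidef P P_pd.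
have lmin0 := posdef_lambda_min_gt0 P n_gt0 P_pd.
have lmax0 : 0 < lambda_max P by apply: lt_le_trans (lambda_min_le_max P n_gt0 sP).
have rho0 : 0 < rho by rewrite divr_gt0 // mulr_gt0.
set D := _ + pbar.
pose eps s : 'cV[R]_ny := \col_j eps2 j s.
have d_le s : T0 <= s -> enorm (K *m v s + K' *m eps s - p s) <= D.
  move=> T0s; have s0 := le_trans T0_ge0 T0s.
  rewrite (le_trans (enormD _ _)) // lerD //; last by rewrite enormN p_bound.
  rewrite (le_trans (enormD _ _)) // lerD //.
    by rewrite (le_trans (enorm_mulmx _ _)) // ler_wpM2l ?opnorm_ge0 ?v_bound.
  rewrite (le_trans (enorm_mulmx _ _)) // ler_wpM2l ?opnorm_ge0 //.
  by apply: enorm_le => j; rewrite mxE eps2_bound.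
have D0 : 0 <= D by apply: le_trans (d_le T0 (lexx _)); exact: enorm_ge0.
have sqrt_lmax0 := sqrtr_ge0 (lambda_max P).
have decay : Num.sqrt (qform P (e t)) <=
    expR (- rho * (t - T0)) * Num.sqrt (qform P (e T0)) +
    Num.sqrt (lambda_max P) * D / rho.
  apply: lyapunov_decay => //; first by rewrite mulr_ge0.
  have F := ae_filter_ringOfSetsType (@lebesgue_measure R).
  apply: filterS2 dx dxh => s hx hxh T0s; have s0 := le_trans T0_ge0 T0s.
  have zE : \col_j (z j s).2 = C *m A *m x s + C *m W *m f (x s) + eps s.
    by apply/colP => j; rewrite mxE z2_rec // [RHS]mxE [eps s j 0]mxE.
  have := is_deriveB (hxh s0) (hx s0).
  rewrite (error_field _ _ _ _ A W B C K K' f u p y (fun t => \col_j (z j t).2)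
    s (x s) (xh s) (v s) (eps s) (y_def s s0) zE).
  set d := _ - p s => de; eexists; first exact: de.
  rewrite bformDr lerD //.
    have [_ lmi_le] := lmi.
    apply: le_trans (lmi_dissipation P _ _ gam lam q _ _ lmi_le (sector _ _)) _.
    have [_ /(_ (e s)) h] := lambda_maxP P n_gt0 sP.
    rewrite -/(e s) !mulNr lerN2 /rho.
    rewrite (_ : q / (2 * lambda_max P) = q / 2 / lambda_max P); last first.
      by field; rewrite gt_eqF.
    have q20 : 0 <= q / 2 by lra.
    by rewrite -[leLHS]mulrA ler_wpM2l // ler_pdivrMl.
  rewrite (le_trans (psd_bform_le P _ _ psdP)) // mulrC ler_wpM2r ?sqrtr_ge0 //.
  rewrite (le_trans (sqrt_qform_le_lambda_max _ _ n_gt0 sP (ltW lmax0))) //.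
  by rewrite ler_wpM2l // d_le.
have lower : Num.sqrt (lambda_min P) * enorm (e t) <= Num.sqrt (qform P (e t)).
  have [_ /(_ (e t)) h] := lambda_minP P n_gt0 sP.
  rewrite -[enorm _]ger0_norm ?enorm_ge0 // -sqrtr_sqr -(sqrtrM _ (ltW lmin0)).
  exact: ler_wsqrtr.
have -> : kappaP = (Num.sqrt (lambda_min P))^-1 * Num.sqrt (lambda_max P).
  by rewrite /kappaP sqrtrM ?ltW // sqrtrV ?ltW // mulrC.
rewrite -[leRHS]mulrA ler_pdivlMl ?sqrtr_gt0 // (le_trans lower) // (le_trans decay) //.
rewrite [leRHS]mulrDr lerD //; last by rewrite mul1r [_^-1 * _]mulrC mulrA.
rewrite mulrCA ler_wpM2l ?expR_ge0 //.
by apply: sqrt_qform_le_lambda_max => //; exact: ltW.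
Qed.
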